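(* Let $C$ be a linear code of length $n$ over a field $\mathbb{F}$ and let $\mathcal{G}$ be a class of groups. (1) $C$ is a left $\mathcal{G}$ group code if and only if $\mathrm{PAut}(C)$ contains a regular subgroup of $S_n$ which belongs to $\mathcal{G}$. (2) $C$ is a $\mathcal{G}$ group code if and only if $\mathrm{PAut}(C)$ contains a regular subgroup $H$ of $S_n$ which belongs to $\mathcal{G}$ and satisfies $C_{S_n}(H)\subseteq \mathrm{PAut}(C)$.
   Context: The field $\mathbb{F}$ need not be finite. A class of groups is understood to be closed under isomorphism. A linear code of length $n$ over $\mathbb{F}$ is a linear subspace of $\mathbb{F}^n$; $E=\{e_1,\dots,e_n\}$ is the standard basis of $\mathbb{F}^n$. $S_n$ is the group of permutations of $\{1,\dots,n\}$, acting linearly on $\mathbb{F}^n$ by $\sigma(e_i)=e_{\sigma(i)}$. A subgroup of $S_n$ is regular if it is transitive and has order $n$. $\mathrm{PAut}(C)=\{\sigma\in S_n:\sigma(C)=C\}$. $C_{S_n}(H)$ is the centralizer of $H$ in $S_n$. For a group $G$ of order $n$, $C$ is a left $G$-code (respectively, a $G$-code) if there is a bijection $\phi:E\to G$ whose linear extension $\phi:\mathbb{F}^n\to\mathbb{F}G$ to the group algebra maps $C$ onto a left ideal (respectively, a two-sided ideal) of $\mathbb{F}G$. $C$ is a left $\mathcal{G}$ group code (respectively, a $\mathcal{G}$ group code) if it is a left $G$-code (respectively, a $G$-code) for some $G\in\mathcal{G}$. *)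

(* Defs.v *)
From mathcomp Require Import all_boot all_fingroup all_algebra all_solvable.
From mathcomp Require Import all_character.

Set Implicit Arguments.
Unset Strict Implicit.
Unset Printing Implicit Defensive.

Import GroupScope.
Local Open Scope ring_scope.

(* A linear code of length n is the row space of a matrix C : 'M[F]_(m, n);   *)
(* the rows of C generate the code but need not be linearly independent.      *)

Definition isomorphic (G1 G2 : groupType) : Prop :=
  exists f : {multiplicative G1 -> G2}, bijective f.

Definition iso_closed (K : groupType -> Prop) : Prop :=
  forall G1 G2 : groupType, isomorphic G1 G2 -> K G1 -> K G2.

Definition regular_subgroup (n : nat) (H : {group 'S_n}) : bool :=
  [transitive H, on [set: 'I_n] | 'P] && (#|H| == n).

Section Codes.

Variables (F : fieldType) (m n : nat).
Implicit Type C : 'M[F]_(m, n).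

(* perm_mx s acts on the right of row vectors by e_i *m perm_mx s = e_(s i).  *)
Definition PAut C : {set 'S_n} := [set s | (C *m perm_mx s == C)%MS].

(* The group algebra of gT is group_ring F [set: gT], in which x : gT is      *)
(* represented by regular_repr F [set: gT] x (right translation by x; this is *)
(* multiplicative in x because matrices act on row vectors). The rows of      *)
(* group_algebra_ext phi are the images phi i of the standard basis vectors,  *)
(* so that v *m group_algebra_ext phi is the linear extension of phi at v.    *)
Definition group_algebra_ext (gT : finGroupType) (phi : 'I_n -> gT) :
    'M[F]_(n, #|[set: gT]| ^ 2) :=
  \matrix_(i < n) mxvec (regular_repr F [set: gT] (phi i)).

Definition left_G_code (gT : finGroupType) C : Prop :=
  exists2 phi : 'I_n -> gT, bijective phi &
    left_mx_ideal (group_ring F [set: gT]) (C *m group_algebra_ext phi).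

Definition G_code (gT : finGroupType) C : Prop :=
  exists2 phi : 'I_n -> gT, bijective phi &
    mx_ideal (group_ring F [set: gT]) (C *m group_algebra_ext phi).

Definition left_class_group_code (K : groupType -> Prop) C : Prop :=
  exists2 gT : finGroupType, K gT & left_G_code gT C.

Definition class_group_code (K : groupType -> Prop) C : Prop :=
  exists2 gT : finGroupType, K gT & G_code gT C.

End Codes.

(* Main.v *)
(* Let phi identify {1, ..., n} with a group G. Left multiplication of FG by  *)
(* an element of G permutes the basis, hence becomes, through phi, a          *)
(* permutation of {1, ..., n}; these permutations form a regular subgroup H   *)
(* isomorphic to G, every regular subgroup arises in this way from its orbit  *)
(* map, and the permutations induced by right multiplication form C(H). Since *)
(* G spans FG, a code is a left (right) ideal if and only if it is invariant  *)
(* under the left (right) multiplications by elements of G, that is under H   *)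
(* (under C(H)).                                                              *)

From HB Require Import structures.
Require Import Defs.
From mathcomp Require Import all_boot all_fingroup all_algebra all_solvable.
From mathcomp Require Import all_character.

Set Implicit Arguments.
Unset Strict Implicit.
Unset Printing Implicit Defensive.

Section GroupRingIdeals.

Import GroupScope GRing.Theory.
Local Open Scope ring_scope.

Variables (F : fieldType) (gT : finGroupType) (G : {group gT}) (m : nat).
Implicit Type C : 'M[F]_(m, #|G| ^ 2).
Let aG := regular_repr F G.

(** The matrices [aG x] span the group ring and the ideal condition is linear in the left factor, so
    it suffices to test group elements. On flattened matrices, [lin_mulmx (aG x)] is left
    multiplication by [aG x]. *)
Lemma left_gring_idealP C :
  reflect {in G, forall x, (C *m lin_mulmx (aG x) <= C)%MS}
          (left_mx_ideal (group_ring F G) C).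
Proof.
apply: (iffP mulsmx_subP) => [idC x Gx | idC A1 A2 /envelop_mxP[a ->] CA2].
  apply/row_subP=> i; rewrite row_mul mul_rV_lin /=.
  by rewrite idC ?envelop_mx_id // vec_mxK row_sub.
rewrite mulmx_suml linear_sum summx_sub //= => x Gx.
rewrite -scalemxAl linearZ scalemx_sub //=.
by apply: submx_trans (idC x Gx); rewrite -mul_vec_lin submxMr.
Qed.

Lemma right_gring_idealP C :
  reflect {in G, forall x, (C *m lin_mulmxr (aG x) <= C)%MS}
          (right_mx_ideal (group_ring F G) C).
Proof.
apply: (iffP mulsmx_subP) => [idC x Gx | idC A1 A2 CA1 /envelop_mxP[a ->]].
  apply/row_subP=> i; rewrite row_mul mul_rV_lin /=.
  by rewrite idC ?envelop_mx_id // vec_mxK row_sub.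
rewrite mulmx_sumr linear_sum summx_sub //= => x Gx.
rewrite -scalemxAr linearZ scalemx_sub //=.
apply: submx_trans (idC x Gx).
by rewrite -[mxvec _]/(mxvec (mulmxr (aG x) A1)) -mul_vec_lin submxMr.
Qed.

End GroupRingIdeals.

(** A permutation matrix is invertible, so it preserves the rank and inclusion already forces
    equality. *)
Lemma in_PAut (F : fieldType) (m n : nat) (C : 'M[F]_(m, n)) (s : 'S_n) :
  (s \in PAut C) = (C *m perm_mx s <= C)%MS%R.
Proof.
rewrite inE; apply/andb_idr=> sC; rewrite -(mxrank_leqif_sup sC).2.
by rewrite mxrankMfree // row_free_unit unitmx_perm.
Qed.

Section Translations.

Import GroupScope GRing.Theory.
Local Open Scope ring_scope.

Variables (gT : finGroupType) (n : nat) (phi : 'I_n -> gT) (psi : gT -> 'I_n).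
Hypotheses (phiK : cancel phi psi) (psiK : cancel psi phi).

Lemma ltrans_inj x : injective (fun i => psi (x^-1 * phi i)%g).
Proof. by move=> i j /(can_inj psiK) /mulgI /(can_inj phiK). Qed.

Lemma rtrans_inj x : injective (fun i => psi (phi i * x)%g).
Proof. by move=> i j /(can_inj psiK) /mulIg /(can_inj phiK). Qed.

(* The inverse makes ltrans a morphism: permutations compose left to right.   *)
Definition ltrans x : 'S_n := perm (@ltrans_inj x).
Definition rtrans x : 'S_n := perm (@rtrans_inj x).

Lemma phi_ltrans x i : phi (ltrans x i) = (x^-1 * phi i)%g.
Proof. by rewrite permE psiK. Qed.

Lemma phi_rtrans x i : phi (rtrans x i) = (phi i * x)%g.
Proof. by rewrite permE psiK. Qed.

Lemma ltransM : {morph ltrans : x y / (x * y)%g}.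
Proof.
move=> x y; apply/permP=> i; apply: (can_inj phiK).
by rewrite permM !phi_ltrans invMg mulgA.
Qed.

Canonical ltrans_morphism :=
  @Morphism _ _ [set: gT] ltrans (in2W ltransM).

Lemma inj_ltrans : injective ltrans.
Proof.
move=> x y /permP/(_ (psi 1%g))/(congr1 phi).
by rewrite !phi_ltrans psiK !mulg1 => /invg_inj.
Qed.

Definition ltrans_group : {group 'S_n} := (ltrans @* [set: gT])%G.

Lemma mem_ltrans x : ltrans x \in ltrans_group.
Proof. by rewrite mem_morphim ?inE. Qed.

Lemma ltrans_groupP s :
  reflect (exists x, s = ltrans x) (s \in ltrans_group).
Proof.
apply: (iffP idP) => [/morphimP[x _ _ ->] | [x ->]]; first by exists x.
exact: mem_ltrans.
Qed.

Lemma ltrans_group_regular : regular_subgroup ltrans_group.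
Proof.
apply/andP; split.
  apply/imsetP; exists (psi 1%g); first by rewrite inE.
  apply/setP=> i; rewrite inE; symmetry; apply/orbitP.
  (* [ltrans g] moves the point labelled 1 to the point labelled by the inverse of [g]. *)
  exists (ltrans (phi i)^-1%g); first exact: mem_ltrans.
  by apply: (can_inj phiK); rewrite /= /aperm phi_ltrans psiK invgK mulg1.
rewrite card_injm ?subsetT //; last by apply/injmP=> x y _ _ /inj_ltrans.
by rewrite cardsT -(bij_eq_card (Bijective phiK psiK)) card_ord.
Qed.

(** Closure under isomorphism then carries membership in the class from [gT] to the regular
    subgroup. *)
Lemma ltrans_group_isomorphic : isomorphic gT (subg_of ltrans_group).
Proof.
pose f x : subg_of ltrans_group := subg ltrans_group (ltrans x).
have fM : {morph f : x y / (x * y)%g}.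
  by move=> x y; rewrite /f ltransM subgM ?mem_ltrans.
pose fMul := isMultiplicative.Build gT (subg_of ltrans_group) f fM.
pose fMorph : {multiplicative gT -> subg_of ltrans_group} := HB.pack f fMul.
exists fMorph.
apply: inj_card_bij => [x y /(congr1 sgval)|].
  by rewrite /= !subgK ?mem_ltrans // => /inj_ltrans.
rewrite card_sub -(card_imset _ inj_ltrans); apply/subset_leq_card/subsetP.
by move=> s /ltrans_groupP[x ->]; apply: imset_f.
Qed.

(** Left and right translations commute by associativity. Conversely, left translations are
    transitive, so a permutation commuting with them is determined by the image of the point
    labelled 1: if 1 goes to g, then every y goes to yg. *)
Lemma rtransP s : reflect (exists x, s = rtrans x) (s \in 'C(ltrans_group))%g.
Proof.
apply: (iffP centP) => [cs | [x ->] _ /ltrans_groupP[y ->]]; last first.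
  apply/permP=> i; apply: (can_inj phiK).
  by rewrite !permM !(phi_ltrans, phi_rtrans) mulgA.
exists (phi (s (psi 1%g))); apply/permP=> i; apply: (can_inj phiK).
have /permP/(_ (psi 1%g)) := cs _ (mem_ltrans (phi i)^-1).
have -> : (s * ltrans (phi i)^-1)%g (psi 1%g) =
  ltrans (phi i)^-1%g (s (psi 1%g)) by rewrite permM.
rewrite permM => /(congr1 phi); rewrite phi_ltrans invgK phi_rtrans => ->.
by congr (phi (s _)); apply: (can_inj phiK); rewrite phi_ltrans psiK invgK mulg1.
Qed.

Variables (F : fieldType) (m : nat) (C : 'M[F]_(m, n)).
Let aG := regular_repr F [set: gT].
Let E := group_algebra_ext F phi.

(** Distinct group elements are linearly independent in the group ring: [gring_proj (phi i)] reads
    off the coefficient of [phi i]. Hence inclusions between codes can be tested on their images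
    under [E]. *)
Lemma group_algebra_ext_free : row_free E.
Proof.
apply: inj_row_free => v vE0; apply/rowP=> i; rewrite mxE.
have: \sum_j v 0 j *: aG (phi j) = 0.
  apply/eqP; rewrite -mxvec_eq0 linear_sum -[X in _ == X]vE0 mulmx_sum_row.
  by apply/eqP/eq_bigr=> j _; rewrite linearZ rowK.
move/(congr1 (gring_proj (phi i))); rewrite linear0 linear_sum /=.
move/matrixP/(_ 0 0); rewrite summxE (bigD1 i) //= big1 => [|j ne_ji].
  by rewrite linearZ /= gring_projE ?inE // eqxx !mxE addr0 mulr1.
rewrite linearZ /= gring_projE ?inE // (can_eq phiK) eq_sym (negbTE ne_ji).
by rewrite !mxE mulr0.
Qed.

(** [E] intertwines the action on coordinates with multiplication in the group algebra; the inverse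
    is the one built into [ltrans]. *)
Lemma mul_perm_ltrans x :
  perm_mx (ltrans x) *m E = E *m lin_mulmx (aG x^-1%g).
Proof.
apply/row_matrixP=> i; rewrite -row_permE row_permEsub row_rowsub row_mul !rowK.
by rewrite mul_vec_lin phi_ltrans repr_mxM ?inE.
Qed.

Lemma mul_perm_rtrans x : perm_mx (rtrans x) *m E = E *m lin_mulmxr (aG x).
Proof.
apply/row_matrixP=> i; rewrite -row_permE row_permEsub row_rowsub row_mul !rowK.
by rewrite mul_vec_lin phi_rtrans /= repr_mxM ?inE.
Qed.

Lemma left_ideal_ltrans :
  left_mx_ideal (group_ring F [set: gT]) (C *m E) =
    (ltrans_group \subset PAut C).
Proof.
have inv x : (ltrans x \in PAut C) =
    (C *m E *m lin_mulmx (aG x^-1%g) <= C *m E)%MS.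
  rewrite in_PAut -(submxMfree _ _ group_algebra_ext_free).
  by rewrite -!mulmxA mul_perm_ltrans.
apply/left_gring_idealP/subsetP => [idC _ /ltrans_groupP[x ->] | sHC x _].
  by rewrite inv idC ?inE.
by rewrite -[x]invgK -inv sHC ?mem_ltrans.
Qed.

Lemma right_ideal_rtrans :
  right_mx_ideal (group_ring F [set: gT]) (C *m E) =
    ('C(ltrans_group) \subset PAut C)%g.
Proof.
have inv x : (rtrans x \in PAut C) =
    (C *m E *m lin_mulmxr (aG x) <= C *m E)%MS.
  rewrite in_PAut -(submxMfree _ _ group_algebra_ext_free).
  by rewrite -!mulmxA mul_perm_rtrans.
apply/right_gring_idealP/subsetP => [idC _ /rtransP[x ->] | sHC x _].
  by rewrite inv idC ?inE.
by rewrite -inv sHC //; apply/rtransP; exists x.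
Qed.

End Translations.

Lemma regular_subgroup_ltrans (n : nat) (H : {group 'S_n}) :
  regular_subgroup H ->
  exists (phi : 'I_n -> subg_of H) (psi : subg_of H -> 'I_n)
    (phiK : cancel phi psi) (psiK : cancel psi phi),
    ltrans_group phiK psiK = H.
Proof.
case/andP=> /imsetP[i0 _ orbH] /eqP cardH.
(* With the inverse here, the point of [x^-1 * h] is the image under [x] of the point of [h], so
   [ltrans x] is [x] itself. *)
pose psi (h : subg_of H) : 'I_n := (sgval h)^-1%g i0.
have psi_onto i : exists h, psi h == i.
  have: i \in orbit 'P H i0 by rewrite -orbH inE.
  case/orbitP=> h Hh <-; exists (subg H h^-1%g).
  by rewrite /psi subgK ?groupV // invgK.
pose phi i := xchoose (psi_onto i).
have phiK : cancel phi psi by move=> i; apply/eqP/(xchooseP (psi_onto i)).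
(* [phi] is only a chosen section of the orbit map; it is injective and [H] has order [n], so it is
   bijective and [psi] is its two-sided inverse. *)
have [psi' phiK' psi'K] : bijective phi.
  apply: inj_card_bij (can_inj phiK) _.
  by rewrite card_sub card_ord -[leqRHS]cardH.
have psiK : cancel psi phi by move=> h; rewrite -[h]psi'K phiK.
exists phi, psi, phiK, psiK; apply/group_inj/eqP.
have lt h : ltrans phiK psiK h = sgval h.
  apply/permP=> i; rewrite permE /psi /= invMg invgK permM.
  by rewrite -[in RHS](phiK i).
rewrite eqEcard; apply/andP; split.
  by apply/subsetP=> _ /ltrans_groupP[h ->]; rewrite lt subgP.
have /andP[_ /eqP->] := ltrans_group_regular phiK psiK.
by rewrite cardH.
Qed.

Theorem corollary1p3 (F : fieldType) (m n : nat) (C : 'M[F]_(m, n))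
    (K : groupType -> Prop) (hK : iso_closed K) :
  (left_class_group_code K C <->
     exists H : {group 'S_n},
       [/\ regular_subgroup H, K (subg_of H) & H \subset PAut C])
  /\
  (class_group_code K C <->
     exists H : {group 'S_n},
       [/\ regular_subgroup H, K (subg_of H), H \subset PAut C
         & ('C(H))%g \subset PAut C]).
Proof.
split; split.
- case=> gT KG [phi [psi phiK psiK]]; rewrite (left_ideal_ltrans phiK psiK).
  exists (ltrans_group phiK psiK); split=> //.
    exact: ltrans_group_regular.
  exact: hK (ltrans_group_isomorphic _ _) KG.
- case=> H [/regular_subgroup_ltrans[phi [psi [phiK [psiK defH]]]] KH sHC].
  exists (subg_of H) => //; exists phi; first by exists psi.
  by rewrite (left_ideal_ltrans phiK psiK) defH.
- case=> gT KG [phi [psi phiK psiK]] /andP[].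
  rewrite (left_ideal_ltrans phiK psiK) (right_ideal_rtrans phiK psiK).
  exists (ltrans_group phiK psiK); split=> //.
    exact: ltrans_group_regular.
  exact: hK (ltrans_group_isomorphic _ _) KG.
case=> H [/regular_subgroup_ltrans[phi [psi [phiK [psiK defH]]]] KH sHC sCHC].
exists (subg_of H) => //; exists phi; first by exists psi.
rewrite /mx_ideal (left_ideal_ltrans phiK psiK) (right_ideal_rtrans phiK psiK).
by rewrite defH sHC.
Qed.
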